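(* Let $k \geq 2$ be an integer, $p$ a prime and $A \subseteq \mathbb{F}_p$. If $|A| < \log_2\log_{2k}\log_{2k^2}p - 1$, then there exist a finite algebraic extension $K$ of $\mathbb{Q}$ of degree at most $(2k)^{2^{|A|}}$, a subset $A' \subset K$ and a ring homomorphism $\phi_p : \mathbb{Z}[A'] \rightarrow \mathbb{F}_p$ such that the restriction of $\phi_p$ to $A'$ is an $F_k$-ring-isomorphism between $A'$ and $A$.
   Context: For a polynomial $f \in \mathbb{Z}[x_1,\ldots,x_n]$, $\|f\|_1$ denotes the sum of the absolute values of its coefficients. For integers $k,t>0$, $f$ is called $(k,t)$-bounded if $\|f\|_1 \leq k$ and $\deg f \leq t$; it is called $k$-bounded if it is $(k,k)$-bounded. For rings $R_1,R_2$ and finite subsets $A\subseteq R_1$, $B\subseteq R_2$, a bijection $\phi: A\to B$ is an $F_k$-ring-isomorphism (Freiman ring-isomorphism of order $k$) if, writing $A=\{a_1,\ldots,a_n\}$, for every $k$-bounded $f\in\mathbb{Z}[x_1,\ldots,x_n]$ we have $f(a_1,\ldots,a_n)=0$ if and only if $f(\phi(a_1),\ldots,\phi(a_n))=0$ (evaluations carried out in the respective rings). $\mathbb{Z}[A']$ denotes the smallest subring of $K$ containing $A'$. *)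

(* Defs.v *)
From HB Require Import structures.
From mathcomp Require Import all_boot all_order all_algebra all_field.
From mathcomp Require Import finmap mpoly boolp reals.
From mathcomp Require exp.

Set Implicit Arguments.
Unset Strict Implicit.
Unset Printing Implicit Defensive.

Import GRing.Theory Num.Theory.
Local Open Scope ring_scope.

(* Since [exp.ln x = 0] for [x <= 0], [logb b x = 0] for [x <= 0]. *)
Definition logb {R : realType} (b x : R) : R := exp.ln x / exp.ln b.

Definition norm1 (n : nat) (f : {mpoly int[n]}) : int :=
  \sum_(m <- msupp f) `|f@_m|.

(* [msize f] is [deg f + 1] for nonzero [f], and [msize 0 = 0]. *)
Definition bounded (k t n : nat) (f : {mpoly int[n]}) : Prop :=
  norm1 f <= k%:Z /\ (msize f <= t.+1)%N.

Definition eval_at (R : comNzRingType) (n : nat) (a : 'I_n -> R)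
    (f : {mpoly int[n]}) : R :=
  mmap (fun z : int => z%:~R) a f.

(* The elements of [A] are listed as [a_i = val (enum_val i)]; boundedness of
   [f] is invariant under renaming variables, so the order does not matter. *)
Definition freiman_ring_iso (k : nat) (R1 R2 : comNzRingType)
    (A : {fset R1}) (B : {fset R2}) (phi : A -> B) : Prop :=
  bijective phi /\
  forall f : {mpoly int[#|{: A}|]}, bounded k k f ->
    (eval_at (fun i => val (enum_val i)) f = 0 <->
     eval_at (fun i => val (phi (enum_val i))) f = 0).

(* The smallest subring [Z[A]] containing [A], first as a predicate (the
   intersection of all subrings containing [A]), then as a ring [Zadj A]. *)
Definition Zspan (R : comNzRingType) (A : {fset R}) : {pred R} :=
  fun x => `[< forall S : {pred R},
                 subring_closed S -> {subset A <= S} -> x \in S >].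

Lemma Zspan_subring (R : comNzRingType) (A : {fset R}) :
  subring_closed (Zspan A).
Proof.
split=> [|x y /asboolP Ax /asboolP Ay|x y /asboolP Ax /asboolP Ay];
  apply/asboolP => S SS AS; case: (SS) => S1 SB SM; first by [].
- by apply: SB; [apply: Ax | apply: Ay].
- by apply: SM; [apply: Ax | apply: Ay].
Qed.

HB.instance Definition _ (R : comNzRingType) (A : {fset R}) :=
  GRing.isSubringClosed.Build R (Zspan A) (Zspan_subring A).

Lemma Zspan_gen (R : comNzRingType) (A : {fset R}) (a : A) :
  val a \in Zspan A.
Proof. by apply/asboolP => S _; apply; apply: valP. Qed.

Record Zadj (R : comNzRingType) (A : {fset R}) : Type :=
  ZAdj { Zadj_val : R; _ : Zadj_val \in Zspan A }.

Section ZadjRing.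
Variables (R : comNzRingType) (A : {fset R}).
HB.instance Definition _ := [isSub for @Zadj_val R A].
HB.instance Definition _ := [Choice of Zadj A by <:].
HB.instance Definition _ :=
  [SubChoice_isSubComNzRing of Zadj A by <:].
End ZadjRing.

Definition Zadj_gen (R : comNzRingType) (A : {fset R}) (a : A) : Zadj A :=
  ZAdj (Zspan_gen a).

(* Main.v *)
(** The variables are eliminated one at a time and the number field is then
    built upwards. Suppose that [a'_1, ..., a'_i] in a number field [L] lift
    [a_1, ..., a_i]: every integer polynomial vanishing at [a'] vanishes at
    [a], and conversely for all polynomials of l1 norm at most [K^(2t)] and
    partial degrees at most [2t^2]. Consider the polynomials [f(a', x)], where
    [f] has norm at most [K], partial degrees at most [t] and vanishes at
    [(a_1, ..., a_(i+1))]. The gcd of all of them is, up to a scalar, a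
    determinantal polynomial [H(a', x)] of a generalized Sylvester matrix; its
    leading coefficient is a minor of size at most [2t], hence within the above
    bounds, so that it survives modulo [p].
    Some irreducible factor [q] of [H(a', x)] is such that [q | G(a', x)]
    implies [G(a_1, ..., a_(i+1)) = 0]: otherwise the product of one bad [G]
    per factor is a multiple of [H(a', x)] not vanishing at
    [(a_1, ..., a_(i+1))], which pseudo-division by [H] forbids. A root of [q]
    is the next [a'_(i+1)]. Since [2 (2t^2) = (2t)^2], the parameters grow as
    [(2k)^(2^i)], and the integers left when all the variables are eliminated
    are smaller than [p]. *)

From HB Require Import structures.
Require Import Defs.
From mathcomp Require Import all_boot all_order all_algebra all_field.
From mathcomp Require Import finmap reals.
From mathcomp Require Import mpoly perm boolp zify.
From mathcomp Require exp.

Set Implicit Arguments.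
Unset Strict Implicit.
Unset Printing Implicit Defensive.

Import Order.TTheory GRing.Theory Num.Theory.
Local Open Scope ring_scope.

(** * Elimination of one variable *)

(** Strong induction on the size: if [h] is not irreducible, it has a nonconstant divisor that is
    not associate to it, hence of smaller size. *)
Lemma irreducible_divisor (L : fieldType) (h : {poly L}) :
  (1 < size h)%N -> exists2 q, irreducible_poly q & q %| h.
Proof.
have [n] := ubnP (size h); elim: n h => // n IHn h le_hn h_gt1.
have [irr_h|] := pselect (irreducible_poly h); first by exists h.
move=> red_h; have [[q [q_neq1 q_h q_ne_h]]|no_q] :=
    pselect (exists q : {poly L}, [/\ size q != 1%N, q %| h & ~~ (q %= h)]);
    last first.
  case: red_h; split=> // q q_neq1 q_h; apply/negPn/negP => q_ne_h.
  by apply: no_q; exists q.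
have h_neq0 : h != 0 by rewrite -size_poly_gt0 (ltn_trans _ h_gt1).
have q_neq0 : q != 0 by apply: contraNneq h_neq0 => q0; rewrite q0 dvd0p in q_h.
have lt_qh : (size q < size h)%N.
  by rewrite ltn_neqAle (dvdp_size_eqp q_h) q_ne_h dvdp_leq.
have [||r irr_r r_q] := IHn q; last by exists r => //; apply: dvdp_trans q_h.
  by apply: leq_trans lt_qh _.
by rewrite ltn_neqAle eq_sym q_neq1 size_poly_gt0.
Qed.

(* By duality: a functional killing all the rows kills ['X^s * h] for
   [s < d + t - e], and these polynomials are in echelon form. *)
Lemma sylvester_row_full (L : fieldType) (m t d e : nat)
    (g w : 'I_m.+1 -> {poly L}) (h : {poly L}) :
    size (g ord0) = d.+1 -> (d <= t)%N -> (forall i, size (g i) <= d.+1)%N ->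
    h = \sum_i w i * g i -> size h = e.+1 ->
  row_full (\matrix_(i < #|{: 'I_m.+1 * 'I_t}|, j < d + t - e)
     ('X^((enum_val i).2) * g (enum_val i).1)`_(e + j)).
Proof.
move=> sz_g0 le_dt sz_g def_h sz_h; set M := \matrix_(_, _) _.
(* Column [k] of the cokernel is read as a functional [ell] on the coefficients of degrees [e] to
   [d + t - 1]; it has to be zero. *)
rewrite -cokermx_eq0; apply/eqP/matrixP => c k; rewrite [RHS]mxE.
pose y j := cokermx M j k; rewrite -/(y c).
pose ell (q : {poly L}) := \sum_(j < d + t - e) q`_(e + j) * y j.
have ellD q1 q2 : ell (q1 + q2) = ell q1 + ell q2.
  by rewrite -big_split; apply: eq_bigr => j _; rewrite coefD mulrDl.
have ellZ b q : ell (b *: q) = b * ell q.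
  by rewrite big_distrr; apply: eq_bigr => j _; rewrite /= coefZ mulrA.
have ell0 : ell 0 = 0 by rewrite -[0](scale0r 0) ellZ mul0r.
have ell_sum (I : finType) (Q : I -> {poly L}) :
  ell (\sum_i Q i) = \sum_i ell (Q i) by exact: (big_morph ell ellD ell0).
have ell_row (s : 'I_t) i : ell ('X^s * g i) = 0.
  have /matrixP/(_ (enum_rank (i, s)) k) := mulmx_coker M.
  rewrite mxE [RHS]mxE => <-; apply: eq_bigr => j _.
  by rewrite [M _ _]mxE enum_rankK.
have ell_short (q : {poly L}) i : (size q <= t)%N -> ell (q * g i) = 0.
  move=> le_qt; rewrite -[q]coefK poly_def mulr_suml ell_sum big1 // => s _.
  by rewrite -scalerAl ellZ (ell_row (widen_ord le_qt s)) mulr0.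
have g0_neq0 : g ord0 != 0 by rewrite -size_poly_eq0 sz_g0.
(* Reduce the cofactors modulo [g ord0]. The remainders have size at most [d <= t], and the
   quotients gather into a single multiple [Q * g ord0]; comparing sizes gives [size Q <= t], so
   [ell] kills every term. *)
have ell_h s : (s < d + t - e)%N -> ell ('X^s * h) = 0.
  move=> lt_s; pose r i : {poly L} := ('X^s * w i) %% g ord0.
  pose Q : {poly L} := \sum_i (('X^s * w i) %/ g ord0) * g i.
  have sz_r i : (size (r i) <= d)%N.
    by rewrite -ltnS -sz_g0 ltn_modp.
  have def_hs : 'X^s * h = \sum_i r i * g i + Q * g ord0.
    rewrite def_h mulr_sumr mulr_suml -big_split; apply: eq_bigr => i _ /=.
    by rewrite mulrA {1}(divp_eq ('X^s * w i) (g ord0)) mulrDl addrC mulrAC.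
  have sz_Q : (size Q <= t)%N.
    have [->|Q_neq0] := eqVneq Q 0; first by rewrite size_poly0.
    suff : (size (Q * g ord0)%R <= d + t)%N.
      by rewrite size_mul // sz_g0 addnS addnC leq_add2l.
    rewrite (_ : Q * g ord0 = 'X^s * h - \sum_i r i * g i); last first.
      by rewrite def_hs addrC addKr.
    apply: leq_trans (size_polyD _ _) _; rewrite size_polyN geq_max.
    apply/andP; split.
      by apply: leq_trans (size_polyMleq _ _) _; rewrite size_polyXn sz_h; lia.
    apply: leq_trans (size_sum _ _ _) _; apply/bigmax_leqP => i _.
    apply: leq_trans (size_polyMleq _ _) _.
    move: (leq_add (sz_r i) (sz_g i)); move: (size _ + size _)%N => z; lia.
  rewrite def_hs ellD ell_sum ell_short // addr0 big1 // => i _.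
  by rewrite ell_short // (leq_trans (sz_r i)).
have [n] := ubnP (nat_of_ord c); elim: n c => // n IHn c; rewrite ltnS => le_cn.
have := ell_h _ (ltn_ord c); rewrite /ell (bigD1 c) //= big1 => [|j j_neq_c].
  rewrite addr0 coefXnM ltnNge leq_addl addnK => /eqP; rewrite mulf_eq0.
  have -> : h`_e = lead_coef h by rewrite lead_coefE sz_h.
  by rewrite lead_coef_eq0 -size_poly_eq0 sz_h => /eqP.
have [lt_jc|le_cj] := ltnP j c.
  by rewrite IHn ?mulr0 // (leq_trans lt_jc).
have lt_cj : (c < j)%N by rewrite ltn_neqAle le_cj eq_sym andbT.
rewrite coefXnM; case: ltnP => // [|_]; first by rewrite mul0r.
by rewrite nth_default ?mul0r // sz_h; lia.
Qed.

Section Elimination.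

Variables (P : comNzRingType) (L F : fieldType).
Variables (u : {rmorphism P -> L}) (v : {rmorphism P -> F}).
Variables (a : F) (T : {poly P} -> Prop) (t : nat).

Hypothesis ker_uv : forall x, u x = 0 -> v x = 0.

Lemma map_poly_ker_uv f : map_poly u f = 0 -> map_poly v f = 0.
Proof.
move=> /polyP fu0; apply/polyP => i.
by have := fu0 i; rewrite !coef_map !coef0 => /ker_uv.
Qed.

(* Pseudo-division by [H] only inverts its leading coefficient, hence it is
   compatible with both specializations. *)
Lemma root_of_dvdp (H G : {poly P}) :
    v (lead_coef H) != 0 -> (map_poly v H).[a] = 0 ->
    map_poly u H %| map_poly u G ->
  (map_poly v G).[a] = 0.
Proof.
move=> vH_neq0 Ha H_G.
have uH_neq0 : u (lead_coef H) != 0.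
  by apply: contraNneq vH_neq0 => /ker_uv ->.
have sz_uH : size (map_poly u H) = size H by rewrite size_map_poly_id0.
have H_neq0 : H != 0.
  by apply: contraNneq uH_neq0 => ->; rewrite lead_coef0 rmorph0.
have lt_Rm := Pdiv.CommonRing.ltn_rmodp G H; rewrite H_neq0 in lt_Rm.
have def_G := Pdiv.ComRing.rdivp_eq H G.
set Q := Pdiv.CommonRing.rdivp G H in def_G.
set Rm := Pdiv.CommonRing.rmodp G H in lt_Rm def_G.
set c := lead_coef H ^+ _ in def_G.
(* [u] preserves the size of [H], so the specialized remainder is a multiple of [map_poly u H] of
   smaller size. *)
have uRm : map_poly u Rm = 0.
  have H_Rm : map_poly u H %| map_poly u Rm.
    have := congr1 (map_poly u) def_G; rewrite map_polyZ rmorphD rmorphM /=.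
    move=> /eqP; rewrite addrC -subr_eq => /eqP <-.
    by apply: dvdp_sub; rewrite -?mul_polyC dvdp_mull.
  apply/eqP; apply: contraTT H_Rm => Rm_neq0; apply/negP => /(dvdp_leq Rm_neq0).
  rewrite sz_uH leqNgt => /negP; apply; apply: leq_ltn_trans lt_Rm.
  exact: size_poly.
have := congr1 (fun q => (map_poly v q).[a]) def_G.
rewrite map_polyZ rmorphD rmorphM /= (map_poly_ker_uv uRm) addr0.
rewrite hornerZ hornerM.
move=> /eqP; rewrite Ha mulr0 mulf_eq0 rmorphXn expf_eq0.
by rewrite (negPf vH_neq0) andbF => /eqP.
Qed.

(** Irreducible factors are split off one by one, with multiplicity, and the corresponding [G] are
    multiplied; the product does not vanish at [a] because [F] is a field. *)
Lemma dvdp_escape (h : {poly L}) :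
    h != 0 ->
    (forall q, irreducible_poly q -> q %| h ->
       exists2 G, q %| map_poly u G & (map_poly v G).[a] != 0) ->
  exists2 G, h %| map_poly u G & (map_poly v G).[a] != 0.
Proof.
have [n] := ubnP (size h); elim: n h => // n IHn h le_hn h_neq0 esc.
have [h_gt1|h_le1] := ltnP 1 (size h); last first.
  exists 1; last by rewrite rmorph1 hornerC oner_eq0.
  by apply: dvdUp; rewrite -size_poly_eq1 eqn_leq h_le1 size_poly_gt0.
have [q irr_q q_h] := irreducible_divisor h_gt1.
have [G1 q_G1 G1a] := esc q irr_q q_h.
have [q_gt1 _] := irr_q.
have def_h : h = (h %/ q) * q by rewrite divpK.
have hq_neq0 : h %/ q != 0.
  by apply: contraNneq h_neq0 => hq0; rewrite def_h hq0 mul0r.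
have q_neq0 : q != 0 by rewrite -size_poly_gt0 (ltn_trans _ q_gt1).
have [|r irr_r r_hq|G2 hq_G2 G2a] := IHn (h %/ q) _ hq_neq0.
- rewrite -ltnS (leq_trans _ le_hn) // ltnS {2}def_h size_mul //.
  by case: (size q) q_gt1 => [|[|z]] // _; rewrite !addnS ltnS leq_addr.
- by apply: esc => //; apply: dvdp_trans r_hq _; apply: divp_dvd.
exists (G2 * G1); first by rewrite rmorphM def_h dvdp_mul.
by rewrite rmorphM hornerM mulf_neq0.
Qed.

Hypothesis t_gt0 : (0 < t)%N.
Hypothesis T_size : forall f, T f -> (size f <= t.+1)%N.
Hypothesis T_root : forall f, T f -> (map_poly v f).[a] = 0.
(** The rows are windows of coefficients of shifts of members of [T]. The bound [t.*2] covers the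
    [d + t - e] columns of the matrix in [sylvester_row_full]. *)
Hypothesis T_minor : forall (r e : nat) (M : 'M[P]_r), (r <= t.*2)%N ->
  (forall i, exists f s, T f /\ forall j, M i j = ('X^s * f)`_(e + j)) ->
  v (\det M) = 0 -> u (\det M) = 0.

(* [H] is a determinantal expression of a generator of the ideal of [L[x]]
   spanned by the specializations of [T]; its leading coefficient is a minor
   of the generalized Sylvester matrix of [T]. *)
Lemma common_divisor :
    (exists2 f, T f & map_poly u f != 0) ->
  exists H : {poly P}, [/\ v (lead_coef H) != 0, (map_poly v H).[a] = 0,
    (size H <= t.+1)%N & forall f, T f -> map_poly u H %| map_poly u f].
Proof.
case=> f1 Tf1 f1_neq0.
(* The ideal of [{poly L}] generated by the specializations of [T]. *)
pose I (w : {poly L}) := exists2 s : seq ({poly L} * {poly P}),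
  (forall x, x \in s -> T x.2) & w = \sum_(x <- s) x.1 * map_poly u x.2.
have IT f : T f -> I (map_poly u f).
  move=> Tf; exists [:: (1, f)]; first by move=> x; rewrite inE => /eqP ->.
  by rewrite big_seq1 mul1r.
have ID w1 w2 : I w1 -> I w2 -> I (w1 + w2).
  case=> [s1 Ts1 ->] [s2 Ts2 ->]; exists (s1 ++ s2); last by rewrite big_cat.
  by move=> x; rewrite mem_cat => /orP[/Ts1|/Ts2].
have IM w1 w2 : I w2 -> I (w1 * w2).
  case=> s Ts ->; exists [seq (w1 * x.1, x.2) | x <- s].
    by move=> _ /mapP[x /Ts Tx ->].
  by rewrite big_map mulr_sumr; apply: eq_bigr => x _; rewrite mulrA.
have I0 : I 0 by exists [::]; rewrite ?big_nil.
have Isum (J : finType) (w : J -> {poly L}) :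
    (forall j, I (w j)) -> I (\sum_j w j).
  by move=> Iw; elim/big_ind: _.
have ex_d : exists n, `[< exists2 f, T f & size (map_poly u f) = n >].
  by exists (size (map_poly u f1)); apply/asboolP; exists f1.
have d_le n : `[< exists2 f, T f & size (map_poly u f) = n >] -> (n <= t.+1)%N.
  move=> /asboolP[f Tf <-]; apply: leq_trans (T_size Tf); exact: size_poly.
case: (ex_maxnP ex_d d_le) => d' /asboolP[f0 Tf0 sz_f0] max_d'.
have {}max_d' f : T f -> (size (map_poly u f) <= d')%N.
  by move=> Tf; apply: max_d'; apply/asboolP; exists f.
have d'_gt0 : (0 < d')%N.
  by rewrite (leq_trans _ (max_d' _ Tf1)) // size_poly_gt0.
case: d' d'_gt0 sz_f0 max_d' => // d _ sz_f0 max_d.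
have le_dt : (d <= t)%N.
  by rewrite -ltnS; apply: d_le; apply/asboolP; exists f0.
(* A nonzero element [h] of least degree [e] in the ideal [I] is a gcd of the specializations. *)
have ex_e : exists n, `[< exists w, [/\ I w, w != 0 & size w = n] >].
  exists d.+1; apply/asboolP; exists (map_poly u f0).
  split=> //; first exact: IT.
  by rewrite -size_poly_eq0 sz_f0.
case: (ex_minnP ex_e) => e' /asboolP[h [Ih h_neq0 sz_h]] min_e'.
have {}min_e' w : I w -> w != 0 -> (e' <= size w)%N.
  by move=> Iw w_neq0; apply: min_e'; apply/asboolP; exists w.
have e'_gt0 : (0 < e')%N by rewrite -sz_h size_poly_gt0.
case: e' e'_gt0 sz_h min_e' => // e _ sz_h min_e.
have le_ed : (e <= d)%N.
  rewrite -ltnS -sz_f0; apply: min_e; first exact: IT.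
  by rewrite -size_poly_eq0 sz_f0.
have I_dvd w f : I w -> w != 0 -> (size w <= e.+1)%N -> T f ->
    w %| map_poly u f.
  move=> Iw w_neq0 sz_w Tf; apply/modp_eq0P/eqP; apply: contraTT sz_w => r_neq0.
  rewrite -ltnNge; apply: leq_ltn_trans (min_e _ _ r_neq0) _; last first.
    by rewrite ltn_modp.
  rewrite (_ : _ %% _ = map_poly u f + - (map_poly u f %/ w) * w).
    by apply: ID; [apply: IT | apply: IM].
  by rewrite {2}(divp_eq (map_poly u f) w) mulNr addrC addKr.
have [s Ts def_h] := Ih.
(* Index 0 is reserved for [f0], of maximal degree [d], with weight 0; it serves as [g ord0] in
   [sylvester_row_full]. *)
pose fs (i : 'I_(size s).+1) : {poly P} := (nth (0, f0) ((0, f0) :: s) i).2.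
pose ws (i : 'I_(size s).+1) : {poly L} := (nth (0, f0) ((0, f0) :: s) i).1.
have Tfs i : T (fs i).
  have : nth (0, f0) ((0, f0) :: s) i \in (0, f0) :: s by rewrite mem_nth.
  by rewrite inE /fs => /orP[/eqP ->|/Ts].
have def_h' : h = \sum_i ws i * map_poly u (fs i).
  rewrite def_h -[LHS]add0r -[X in X + _](mul0r (map_poly u f0)).
  rewrite -(big_cons _ _ (0, f0) s xpredT
    (fun x : {poly L} * {poly P} => x.1 * map_poly u x.2)).
  by rewrite (big_nth (0, f0)) big_mkord.
have := @sylvester_row_full L _ t d e (fun i => map_poly u (fs i)) ws h
   sz_f0 le_dt (fun i => max_d _ (Tfs i)) def_h' sz_h.
have r_gt0 : (0 < d + t - e)%N by lia.
have le_r : (d + t - e <= t.*2)%N by lia.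
have def_dt : (d + t = e + (d + t - e))%N by lia.
move: (d + t - e)%N r_gt0 le_r def_dt => r r_gt0 le_r def_dt.
set M := (X in row_full X) => M_full.
(* [kap] selects [r] rows of [M] forming an invertible matrix; [N] is the lift of this matrix to
   [P]. *)
pose kap := fullrankfun M_full.
have N_unit := fullrowsub_unit M_full; rewrite -/kap in N_unit.
pose c0 := Ordinal r_gt0.
pose sc c := nat_of_ord (enum_val (kap c)).2.
pose fc c := fs (enum_val (kap c)).1.
have sz_fc c : (size (map_poly u ('X^(sc c) * fc c)) <= d + t)%N.
  rewrite rmorphM /= map_polyXn; apply: leq_trans (size_polyMleq _ _) _.
  rewrite size_polyXn addSn /= addnC.
  have := max_d _ (Tfs (enum_val (kap c)).1).
  have := ltn_ord (enum_val (kap c)).2.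
  rewrite -/(sc c) -/(fc c); move: (size _) (sc c) => y z; lia.
pose N : 'M[P]_r := \matrix_(c, j) ('X^(sc c) * fc c)`_(e + j).
have uN : map_mx u N = rowsub kap M.
  apply/matrixP => c j; rewrite !mxE -coef_map rmorphM /=.
  by rewrite map_polyXn.
have uD : u (\det N) != 0 by rewrite -det_map_mx uN -unitfE -unitmxE.
have vD : v (\det N) != 0.
  apply: contraNneq uD => vD; apply/eqP; apply: T_minor vD => // c.
  by exists (fc c), (sc c); split=> [|j]; [apply: Tfs | rewrite mxE].
(* This is the determinant of [N] with column 0 replaced by the polynomials themselves. Its
   coefficient at [e + j] is [\det N] for [j = 0], and for [0 < j < r] it is a determinant with a
   repeated column. *)
pose H1 := \sum_c cofactor N c c0 *: ('X^(sc c) * fc c).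
have H1_coef (j : 'I_r) : H1`_(e + j) = (\det N) *+ (c0 == j).
  have /matrixP/(_ c0 j) := mul_adj_mx N; rewrite !mxE => <-.
  by rewrite coef_sum; apply: eq_bigr => c _; rewrite coefZ !mxE.
have H1_high i : (e < i)%N -> u H1`_i = 0.
  move=> lt_ei; have [lt_ir|le_ri] := ltnP i (d + t).
    have lt_r : (i - e < r)%N by lia.
    have -> : i = (e + Ordinal lt_r)%N by rewrite /= subnKC // ltnW.
    rewrite H1_coef -val_eqE /= (_ : (0 == i - e)%N = false) ?rmorph0 //; lia.
  rewrite -coef_map nth_default // (leq_trans _ le_ri) // raddf_sum /=.
  apply: leq_trans (size_sum _ _ _) _; apply/bigmax_leqP => c _.
  by rewrite map_polyZ (leq_trans (size_scale_leq _ _)).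
(* The coefficients of [H1] of degree at least [d + t] are only known to vanish under [u], hence
   under [v]. Truncation makes [\det N] the leading coefficient without changing either
   specialization. *)
pose H := \poly_(i < e.+1) H1`_i.
have H1e : H1`_e = \det N by rewrite -[in LHS](addn0 e) (H1_coef c0) eqxx.
have D_neq0 : \det N != 0 by apply: contraNneq uD => ->; rewrite rmorph0.
have sz_H : size H = e.+1 by rewrite size_poly_eq //= H1e.
have lead_H : lead_coef H = \det N by rewrite lead_coef_poly //= H1e.
have uH : map_poly u H = map_poly u H1.
  apply/polyP => i; rewrite !coef_map coef_poly ltnS.
  by case: leqP => // /H1_high H1i; apply: etrans (rmorph0 u) (esym H1i).
have vH : map_poly v H = map_poly v H1.
  apply/polyP => i; rewrite !coef_map coef_poly ltnS.
  by case: leqP => // /H1_high/ker_uv H1i; apply: etrans (rmorph0 v) (esym H1i).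
exists H; split; first by rewrite lead_H.
- rewrite vH raddf_sum horner_sum big1 // => c _ /=.
  move: (cofactor _ _ _) => b.
  by rewrite map_polyZ rmorphM /= hornerZ hornerM (T_root (Tfs _)) !mulr0.
- by rewrite sz_H ltnS (leq_trans le_ed).
move=> f Tf; apply: I_dvd => //.
- rewrite uH raddf_sum; apply: Isum => c /=.
  move: (cofactor _ _ _) => b; rewrite map_polyZ rmorphM /= scalerAl.
  by apply: IM; apply: IT; apply: Tfs.
- by rewrite -lead_coef_eq0 lead_coef_map_id0 ?lead_H ?rmorph0.
by rewrite -sz_H size_poly.
Qed.

Lemma elimination_step :
    (exists n : nat, a = n%:R) ->
  exists q : {poly L}, [/\ irreducible_poly q, (size q <= t.+1)%N,
    forall f, T f -> q %| map_poly u f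
    & forall G, q %| map_poly u G -> (map_poly v G).[a] = 0].
Proof.
case=> n def_a.
(* If every member of [T] specializes to 0, there is no constraint on the lift of [a], and the
   integer [n] is chosen as its root. *)
have [exT|noT] := pselect (exists2 f, T f & map_poly u f != 0); last first.
  exists ('X - n%:R%:P); split.
  - by rewrite -polyCN; apply: irredp_XaddC.
  - by rewrite size_XsubC.
  - move=> f Tf; have [->|f_neq0] := eqVneq (map_poly u f) 0.
      exact: dvdp0.
    by case: noT; exists f.
  move=> G; rewrite dvdp_XsubCl /root -(rmorph_nat u) horner_map => /eqP.
  by move=> /ker_uv; rewrite -horner_map rmorph_nat -def_a.
have [H [vH Ha sz_H H_dvd]] := common_divisor exT.
have uH : map_poly u H != 0.
  apply: contraNneq vH => uH0; rewrite -(coef_map v) (map_poly_ker_uv uH0).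
  by rewrite coef0.
apply: contrapT => no_q.
have [q irr_q q_H|G H_G /eqP []] := @dvdp_escape (map_poly u H) uH; last first.
  exact: root_of_dvdp vH Ha H_G.
apply: contrapT => no_G; apply: no_q; exists q; split=> //.
- apply: leq_trans sz_H; apply: leq_trans (dvdp_leq uH q_H) _; exact: size_poly.
- by move=> f Tf; apply: dvdp_trans q_H (H_dvd f Tf).
move=> G q_G; apply: contrapT => /eqP Ga; apply: no_G; by exists G.
Qed.

End Elimination.

(** * Iterated polynomial rings *)

(* The instances are the iterated polynomial rings over [int], where [nrm] is
   the l1 norm and [dgr t f] says that every partial degree of [f] is at most
   [t]. *)
Record sizedRing := SizedRing {
  carrier :> comNzRingType;
  nrm : carrier -> nat;
  dgr : nat -> carrier -> Prop;
  nrm0 : nrm 0 = 0%N;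
  nrm1 : (nrm 1 <= 1)%N;
  nrmN : forall x, nrm (- x) = nrm x;
  nrmD : forall x y, (nrm (x + y) <= nrm x + nrm y)%N;
  nrmM : forall x y, (nrm (x * y) <= nrm x * nrm y)%N;
  dgr0 : forall t, dgr t 0;
  dgr1 : dgr 0 1;
  dgrW : forall s t x, (s <= t)%N -> dgr s x -> dgr t x;
  dgrN : forall t x, dgr t x -> dgr t (- x);
  dgrD : forall t x y, dgr t x -> dgr t y -> dgr t (x + y);
  dgrM : forall s t x y, dgr s x -> dgr t y -> dgr (s + t) (x * y)
}.

Section SizedRingTheory.

Variable P : sizedRing.

Lemma nrm_sum (I : Type) (r : seq I) (Q : pred I) (F : I -> P) :
  (nrm (\sum_(i <- r | Q i) F i) <= \sum_(i <- r | Q i) nrm (F i))%N.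
Proof.
elim/big_rec2: _ => [|i y x _ le_xy]; first by rewrite nrm0.
by apply: leq_trans (nrmD _ _) _; rewrite leq_add2l.
Qed.

Lemma nrm_prod (I : Type) (r : seq I) (Q : pred I) (F : I -> P) :
  (nrm (\prod_(i <- r | Q i) F i) <= \prod_(i <- r | Q i) nrm (F i))%N.
Proof.
elim/big_rec2: _ => [|i y x _ le_xy]; first exact: nrm1.
by apply: leq_trans (nrmM _ _) _; rewrite leq_mul2l le_xy orbT.
Qed.

Lemma nrm_int (z : int) : (nrm (z%:~R : P) <= `|z|)%N.
Proof.
have nrm_nat n : (nrm (n%:R : P) <= n)%N.
  elim: n => [|n IHn]; first by rewrite nrm0.
  by rewrite -addn1 natrD (leq_trans (nrmD _ _)) // leq_add ?nrm1.
by case: z => n; rewrite ?NegzE ?rmorphN /= ?nrmN nrm_nat.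
Qed.

Lemma dgr_sum t (I : Type) (r : seq I) (Q : pred I) (F : I -> P) :
  (forall i, Q i -> dgr t (F i)) -> dgr t (\sum_(i <- r | Q i) F i).
Proof. by move=> dF; elim/big_ind: _ => //; [apply: dgr0 | apply: dgrD]. Qed.

Lemma dgr_prod (I : Type) (r : seq I) (d : I -> nat) (F : I -> P) :
  (forall i, dgr (d i) (F i)) -> dgr (\sum_(i <- r) d i) (\prod_(i <- r) F i).
Proof.
move=> dF; elim/big_ind2: _ => //; first exact: dgr1.
by move=> *; apply: dgrM.
Qed.

Lemma dgr_int (z : int) : dgr 0 (z%:~R : P).
Proof.
have dgr_nat n : dgr 0 (n%:R : P).
  by elim: n => [|n IHn]; [apply: dgr0 | rewrite -addn1 natrD; apply/dgrD/dgr1].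
by case: z => n; rewrite ?NegzE ?rmorphN /=; [|apply: dgrN]; apply: dgr_nat.
Qed.

Lemma nrm_sign (s : bool) (x : P) : nrm ((-1) ^+ s * x) = nrm x.
Proof. by case: s; rewrite ?expr1 ?mulN1r ?nrmN // mul1r. Qed.

(** The product of row sums expands over all maps from rows to columns; the Leibniz formula involves
    only the permutations among them. *)
Lemma nrm_det r (M : 'M[P]_r) :
  (nrm (\det M) <= \prod_i \sum_j nrm (M i j))%N.
Proof.
rewrite bigA_distr_bigA /=; apply: leq_trans (nrm_sum _ _ _) _.
apply: leq_trans (_ : \sum_(s : {perm 'I_r}) \prod_i nrm (M i (s i)) <= _)%N.
  by apply: leq_sum => s _; rewrite nrm_sign nrm_prod.
pose h (s : {perm 'I_r}) : {ffun 'I_r -> 'I_r} := [ffun i => s i].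
have h_inj : injective h.
  by move=> s1 s2 /ffunP h12; apply/permP => i; have := h12 i; rewrite !ffunE.
pose G (f : {ffun 'I_r -> 'I_r}) := (\prod_i nrm (M i (f i)))%N.
rewrite (eq_bigr (fun s => G (h s))) => [|s _]; last first.
  by apply: eq_bigr => i _; rewrite ffunE.
rewrite (eq_bigl (fun s => s \in [set: {perm 'I_r}])) => [|s]; last first.
  by rewrite inE.
rewrite -(big_imset G) /=; last by move=> s1 s2 _ _; apply: h_inj.
by rewrite big_mkcond leq_sum // => f _; case: ifP.
Qed.

Lemma dgr_det r t (M : 'M[P]_r) :
  (forall i j, dgr t (M i j)) -> dgr (r * t) (\det M).
Proof.
move=> dM; apply: dgr_sum => s _.
have dP : dgr (r * t) (\prod_i M i (s i)).
  have := dgr_prod (index_enum _) (fun i => dM i (s i)).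
  by rewrite sum_nat_const card_ord.
by case: (odd_perm s); rewrite ?mulN1r ?mul1r //; apply: dgrN.
Qed.

Definition poly_nrm (f : {poly P}) := (\sum_(i < size f) nrm f`_i)%N.

Definition poly_dgr t (f : {poly P}) :=
  (size f <= t.+1)%N /\ forall i, dgr t f`_i.

Lemma poly_nrmE n (f : {poly P}) :
  (size f <= n)%N -> poly_nrm f = (\sum_(i < n) nrm f`_i)%N.
Proof.
move=> le_fn; rewrite /poly_nrm (big_ord_widen n (fun i => nrm f`_i)) //.
rewrite big_mkcond; apply: eq_bigr => i _; case: ltnP => // le_fi.
by rewrite nth_default ?nrm0.
Qed.

Lemma poly_nrmMX f : poly_nrm (f * 'X) = poly_nrm f.
Proof.
rewrite (@poly_nrmE (size f).+1).
  rewrite big_ord_recl coefMX nrm0 add0n; apply: eq_bigr => i _.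
  by rewrite coefMX.
by rewrite (leq_trans (size_polyMleq _ _)) // size_polyX addn2.
Qed.

Lemma poly_nrmMXn n f : poly_nrm ('X^n * f) = poly_nrm f.
Proof.
elim: n => [|n IHn]; first by rewrite mul1r.
by rewrite exprSr mulrAC poly_nrmMX.
Qed.

Lemma poly_nrmC c : poly_nrm c%:P = nrm c.
Proof.
by rewrite (poly_nrmE (size_polyC_leq1 c)) big_ord1 coefC eqxx.
Qed.

Fact poly_nrm0 : poly_nrm 0 = 0%N.
Proof. by rewrite /poly_nrm size_poly0 big_ord0. Qed.

Fact poly_nrm1 : (poly_nrm 1 <= 1)%N.
Proof. by rewrite poly_nrmC nrm1. Qed.

Fact poly_nrmN f : poly_nrm (- f) = poly_nrm f.
Proof.
by rewrite /poly_nrm size_polyN; apply: eq_bigr => i _; rewrite coefN nrmN.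
Qed.

Fact poly_nrmD f g : (poly_nrm (f + g) <= poly_nrm f + poly_nrm g)%N.
Proof.
pose n := maxn (size f) (size g).
rewrite (poly_nrmE (size_polyD f g)) (@poly_nrmE n f) ?leq_maxl //.
rewrite (@poly_nrmE n g) ?leq_maxr // -big_split; apply: leq_sum => i _ /=.
by rewrite coefD nrmD.
Qed.

Fact poly_nrmM f g : (poly_nrm (f * g) <= poly_nrm f * poly_nrm g)%N.
Proof.
have nrmC c : (poly_nrm (c%:P * g) <= nrm c * poly_nrm g)%N.
  rewrite mul_polyC (poly_nrmE (size_scale_leq _ _)) big_distrr /=.
  by apply: leq_sum => i _; rewrite coefZ nrmM.
elim/poly_ind: f => [|f c IHf]; first by rewrite mul0r poly_nrm0.
(* Equality holds because [f * 'X] and [c%:P] have no degree in common. *)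
have -> : poly_nrm (f * 'X + c%:P) = (nrm c + poly_nrm f)%N.
  rewrite (@poly_nrmE (size f).+1).
    rewrite big_ord_recl coefD coefMX coefC add0r; congr (_ + _)%N.
    by apply: eq_bigr => i _; rewrite coefD coefMX coefC addr0.
  apply: leq_trans (size_polyD _ _) _; rewrite geq_max.
  rewrite (leq_trans (size_polyC_leq1 c)) // andbT.
  by rewrite (leq_trans (size_polyMleq _ _)) // size_polyX addn2.
rewrite mulrDl mulrAC (leq_trans (poly_nrmD _ _)) // poly_nrmMX mulnDl addnC.
by rewrite leq_add.
Qed.

Fact poly_dgr0 t : poly_dgr t 0.
Proof. by split=> [|i]; rewrite ?size_poly0 // coef0; apply: dgr0. Qed.

Lemma poly_dgrC t c : dgr t c -> poly_dgr t c%:P.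
Proof.
move=> dc; split=> [|i]; first by rewrite (leq_trans (size_polyC_leq1 c)).
by rewrite coefC; case: eqP => // _; apply: dgr0.
Qed.

Fact poly_dgr1 : poly_dgr 0 1.
Proof. exact/poly_dgrC/dgr1. Qed.

Fact poly_dgrW s t f : (s <= t)%N -> poly_dgr s f -> poly_dgr t f.
Proof.
move=> le_st [sz_f df].
by split=> [|i]; [apply: leq_trans sz_f _ | apply: dgrW (df i)].
Qed.

Fact poly_dgrN t f : poly_dgr t f -> poly_dgr t (- f).
Proof.
by case=> sz_f df; split=> [|i]; rewrite ?size_polyN // coefN; apply: dgrN.
Qed.

Fact poly_dgrD t f g : poly_dgr t f -> poly_dgr t g -> poly_dgr t (f + g).
Proof.
move=> [sz_f df] [sz_g dg]; split=> [|i]; last by rewrite coefD; apply: dgrD.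
by rewrite (leq_trans (size_polyD _ _)) // geq_max sz_f.
Qed.

Fact poly_dgrM s t f g :
  poly_dgr s f -> poly_dgr t g -> poly_dgr (s + t) (f * g).
Proof.
move=> [sz_f df] [sz_g dg]; split=> [|i].
  rewrite (leq_trans (size_polyMleq _ _)) //.
  by move: (size f) (size g) sz_f sz_g => y z; lia.
by rewrite coefM; apply: dgr_sum => j _; apply: dgrM.
Qed.

Definition polySized : sizedRing :=
  SizedRing poly_nrm0 poly_nrm1 poly_nrmN poly_nrmD poly_nrmM
    poly_dgr0 poly_dgr1 poly_dgrW poly_dgrN poly_dgrD poly_dgrM.

Lemma poly_nrmX : poly_nrm 'X = nrm (1 : P).
Proof. by rewrite -[X in poly_nrm X]mul1r poly_nrmMX poly_nrmC. Qed.

Lemma poly_dgrX : poly_dgr 1 'X.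
Proof.
split=> [|i]; first by rewrite size_polyX.
by rewrite coefX; case: eqP => _; [apply: (@dgrW P 0 1) (dgr1 P) | apply: dgr0].
Qed.

End SizedRingTheory.

Definition intSized : sizedRing.
Proof.
apply: (@SizedRing int absz (fun _ _ => True)) => //.
- exact: abszN.
- by move=> x y; lia.
- by move=> x y; rewrite abszM.
Defined.

(** Nested univariate rings make the elimination of the outermost variable an induction step on
    [n]. *)
Fixpoint iterPoly (n : nat) : sizedRing :=
  if n is m.+1 then polySized (iterPoly m) else intSized.

Lemma iterPoly_vars n : exists X : 'I_n -> iterPoly n,
  (forall i, (nrm (X i) <= 1)%N /\ dgr 1 (X i)) /\
  forall (R : comNzRingType) (b : 'I_n -> R),
    exists v : {rmorphism iterPoly n -> R}, forall i, v (X i) = b i.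
Proof.
elim: n => [|n [X [X_le Xv]]].
  exists (fun _ => 0); split=> [[]//|R b].
  by exists (intmul 1 : {rmorphism int -> R}) => -[].
exists (fun i => if unlift ord0 i is Some j then (X j)%:P else 'X).
split=> [i|R b].
  case: unliftP => [j _|_] /=; last first.
    by rewrite poly_nrmX nrm1; split=> //; apply: poly_dgrX.
  have [nX dX] := X_le j.
  by rewrite poly_nrmC; split=> //; apply: poly_dgrC.
have [v vX] := Xv R (fun j => b (lift ord0 j)).
have cv : commr_rmorph v (b ord0) by move=> x; apply: mulrC.
exists (horner_morph cv : {rmorphism {poly iterPoly n} -> R}) => i.
by case: unliftP => [j ->|->] /=; rewrite ?horner_morphC ?horner_morphX ?vX.
Qed.

(** * Bounds on Sylvester minors and construction of the number field *)

Lemma poly_nrm_window (P : sizedRing) e r (g : {poly P}) :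
  (\sum_(j < r) nrm g`_(e + j) <= poly_nrm g)%N.
Proof.
rewrite (@poly_nrmE P (e + (r + size g))); last by rewrite addnA leq_addl.
rewrite big_split_ord /= (leq_trans _ (leq_addl _ _)) //.
by rewrite big_split_ord leq_addr.
Qed.

(* By the Leibniz formula, the l1 norm of a determinant is at most the product
   of the l1 norms of its rows, here windows of coefficients of ['X^s * f]. *)
Lemma sylvester_minor_bounded (P : sizedRing) (K t r e : nat) (M : 'M[P]_r) :
    (forall i, exists f s, (poly_nrm f <= K)%N /\ poly_dgr t f /\
       forall j, M i j = ('X^s * f)`_(e + j)) ->
  (nrm (\det M) <= K ^ r)%N /\ dgr (r * t) (\det M).
Proof.
move=> rowM; split.
  apply: leq_trans (nrm_det M) _.
  rewrite -[r in (K ^ r)%N]card_ord -prod_nat_const.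
  apply: leq_prod => i _; have [f [s [nf [_ Mi]]]] := rowM i.
  under eq_bigr do rewrite Mi.
  by rewrite (leq_trans (poly_nrm_window _ _ _)) // poly_nrmMXn.
apply: dgr_det => i j; have [f [s [_ [[_ df] ->]]]] := rowM i.
by rewrite coefXnM; case: ltnP => // _; apply: dgr0.
Qed.

Lemma rmorph_poly_horner (P R : comNzRingType) (v : {rmorphism {poly P} -> R})
    (w : {rmorphism P -> R}) (f : {poly P}) :
  (forall c, w c = v c%:P) -> v f = (map_poly w f).[v 'X].
Proof.
move=> wE; elim/poly_ind: f => [|f c IHf]; first by rewrite !rmorph0 horner0.
rewrite !(rmorphD, rmorphM) /= map_polyX map_polyC IHf.
by rewrite hornerD hornerMX hornerC; congr (_ + _); apply: esym (wE c).
Qed.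

(** If [q] does not divide [g], the two are coprime, and remain so over [L1], which excludes a
    common root. *)
Lemma irreducible_root (L : fieldType) (L1 : fieldExtType L) (q g : {poly L})
    (z : L1) :
    irreducible_poly q -> root (map_poly (in_alg L1) q) z ->
  ((map_poly (in_alg L1) g).[z] == 0) = (q %| g).
Proof.
move=> irr_q qz; apply/idP/idP => [gz|/dvdpP[h ->]]; last first.
  by rewrite rmorphM hornerM (rootP qz) mulr0.
apply: contraTT gz; rewrite -irreducible_poly_coprime //.
by rewrite -(coprimep_map (in_alg L1)) => /coprimep_root; apply.
Qed.

(** Eliminating one variable replaces [(K, t)] by [(K ^ (2 * t), 2 * t * t)], which squares [2 * t];
    the exponents of [2 * t] add up to [1 + 2 + ... + 2 ^ (n - 1) = 2 ^ n - 1]. Each adjunction has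
    degree at most the current [t], so the same exponent bounds the total degree. *)
Lemma number_field_lift p n K t (v : {rmorphism iterPoly n -> 'F_p}) :
    prime p -> (0 < K)%N -> (0 < t)%N -> (K ^ (2 * t) ^ (2 ^ n - 1) < p)%N ->
  exists (L : fieldExtType rat) (u : {rmorphism iterPoly n -> L}),
    [/\ (\dim {:L} <= (2 * t) ^ (2 ^ n - 1))%N, forall x, u x = 0 -> v x = 0
      & forall x, (nrm x <= K)%N -> dgr t x -> v x = 0 -> u x = 0].
Proof.
move=> p_pr; elim: n K t v => [|n IHn] K t v K_gt0 t_gt0 lt_p.
  (* Adjoining a root of ['X] gives the rationals as an extension of degree 1. *)
  have irrX : irreducible_poly ('X : {poly rat}).
    by rewrite -['X]addr0 -polyC0; apply: irredp_XaddC.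
  have [L dimL _] := irredp_FAdjoin irrX.
  exists L, (intmul 1 : {rmorphism int -> L}); split.
  - by rewrite dimL size_polyX.
  - move=> z /= /eqP; rewrite -(rmorph_int (in_alg L)) fmorph_eq0 intr_eq0.
    by move/eqP ->; rewrite rmorph0.
  move=> z /= le_zK _; rewrite -[z]intz rmorph_int => /eqP.
  rewrite expn0 expn1 in lt_p.
  have -> : (z%:~R == 0 :> 'F_p) = (`|z|%:R == 0 :> 'F_p).
    by case: z {le_zK} => m //=; rewrite NegzE rmorphN oppr_eq0.
  rewrite -(dvdn_pcharf (pchar_Fp p_pr)) => /dvdn_leq p_le.
  have [->|z_neq0] := eqVneq z 0; first by rewrite rmorph0.
  by have := p_le; rewrite absz_gt0 z_neq0; lia.
pose v0 : {rmorphism iterPoly n -> 'F_p} := v \o polyC.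
have vE f : v f = (map_poly v0 f).[v 'X] by apply: rmorph_poly_horner.
have expE : (2 ^ n.+1 - 1 = 1 + 2 * (2 ^ n - 1))%N.
  by rewrite expnS; have := expn_gt0 2 n; lia.
have sqE : (2 * (2 * t * t) = (2 * t) ^ 2)%N by rewrite expnS expn1; lia.
have [|||L0 [u0 [dimL0 ker0 bnd0]]] := IHn (K ^ (2 * t))%N (2 * t * t)%N v0.
- by rewrite expn_gt0 K_gt0.
- by rewrite !muln_gt0 t_gt0.
- by rewrite -expnM sqE -expnM -{1}(expn1 (2 * t)) -expnD -expE.
pose T (f : {poly iterPoly n}) :=
  [/\ (poly_nrm f <= K)%N, poly_dgr t f & v f = 0].
have [||||q [irr_q sz_q q_T q_ker]] :=
  @elimination_step _ _ _ u0 v0 (v 'X) T t ker0 t_gt0.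
- by move=> f [_ []].
- by move=> f [_ _]; rewrite vE.
- move=> r e M le_r rowM; have [|nM dM] := @sylvester_minor_bounded _ K t r e M.
    by move=> i; have [f [s [[nf df _] Mi]]] := rowM i; exists f, s.
  apply: bnd0; first by rewrite (leq_trans nM) // leq_pexp2l // mul2n.
  by apply: dgrW dM; rewrite leq_mul2r mul2n le_r orbT.
(* Every element of the prime field is the image of a natural number. *)
- by exists (v 'X : nat); rewrite natr_Zp.
have [L1 dimL1 [z qz _]] := irredp_FAdjoin irr_q.
pose w : {rmorphism iterPoly n -> L1} := in_alg L1 \o u0.
have cw : commr_rmorph w z by move=> x; apply: mulrC.
pose L : fieldExtType rat := baseFieldType L1.
pose u : {rmorphism {poly iterPoly n} -> L} := horner_morph cw.
have uE f : (u f == 0) = (q %| map_poly u0 f).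
  by rewrite -(irreducible_root _ irr_q qz) -map_poly_comp.
exists L, u; split.
- have -> : \dim {:L} = (\dim {:L1} * \dim {:L0})%N.
    rewrite -dim_baseVspace; congr (\dim _); apply/vspaceP => x.
    by rewrite mem_baseVspace memvf; apply: esym (memvf (x : L1)).
  rewrite dimL1 expE expnD expn1 leq_mul //; first by lia.
  by rewrite (leq_trans dimL0) // sqE -expnM.
- by move=> f /eqP; rewrite uE vE => /q_ker.
by move=> f nf df vf; apply/eqP; rewrite uE; apply: q_T.
Qed.

(** * Freiman ring-isomorphisms *)

(** Monomials in the [Y i] have norm at most 1, so the norm is controlled by the coefficients alone;
    the bound on the total degree is passed on to [dgr]. *)
Lemma eval_at_bounded (P : sizedRing) (k t n : nat) (f : {mpoly int[n]})
    (Y : 'I_n -> P) :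
    bounded k t f -> (forall i, (nrm (Y i) <= 1)%N /\ dgr 1 (Y i)) ->
  (nrm (eval_at Y f) <= k)%N /\ dgr t (eval_at Y f).
Proof.
case=> nf df Y_le.
have nm m : (nrm (mmap1 Y m) <= 1)%N.
  apply: leq_trans (nrm_prod _ _ _) _.
  apply: (@leq_trans (\prod_(i < n) 1)%N); last by rewrite big1.
  apply: leq_prod => i _; elim: (m i) => [|d IHd]; first exact: nrm1.
  rewrite exprS (leq_trans (nrmM _ _)) //.
  exact: leq_mul (Y_le i).1 IHd.
have dm m : dgr (mdeg m) (mmap1 Y m).
  rewrite mdegE; apply: dgr_prod => i.
  elim: (m i) => [|d IHd]; first exact: dgr1.
  by rewrite exprS -add1n; apply: dgrM => //; apply: (Y_le i).2.
split.
  apply: leq_trans (nrm_sum _ _ _) _; rewrite -lez_nat; apply: le_trans nf.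
  rewrite /norm1 -[X in (X <= _)%R]natz natr_sum; apply: ler_sum => m _.
  rewrite natz -abszE lez_nat (leq_trans (nrmM _ _)) //.
  by rewrite -[leqRHS]muln1 leq_mul ?nrm_int.
rewrite /eval_at /mmap big_seq; apply: dgr_sum => m /msize_mdeg_lt lt_m.
apply: (@dgrW P (mdeg m)); first by rewrite -ltnS (leq_trans lt_m).
by rewrite -[mdeg m]add0n; apply: dgrM; [apply: dgr_int | apply: dm].
Qed.

Lemma rmorph_eval_at (P R : comNzRingType) (v : {rmorphism P -> R}) n
    (f : {mpoly int[n]}) (Y : 'I_n -> P) :
  v (eval_at Y f) = eval_at (fun i => v (Y i)) f.
Proof.
rewrite /eval_at /mmap rmorph_sum; apply: eq_bigr => m _.
rewrite rmorphM rmorph_int rmorph_prod; congr (_ * _).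
by apply: eq_bigr => i _; rewrite rmorphXn.
Qed.

(** The image of [u] is a subring containing [A], hence [Zadj A]. Applying [v] to a preimage is
    independent of the choice, since the kernel of [u] lies in that of [v]. *)
Lemma Zadj_rmorphism (P K F : comNzRingType) (u : {rmorphism P -> K})
    (v : {rmorphism P -> F}) (A : {fset K}) :
    (forall x, u x = 0 -> v x = 0) ->
    (forall a, a \in A -> exists x, u x = a) ->
  exists phi : {rmorphism Zadj A -> F},
    forall y x, Zadj_val y = u x -> phi y = v x.
Proof.
move=> ker_uv uA.
have lift (y : Zadj A) : exists x, u x = Zadj_val y.
  case: y => y /= /asboolP /(_ (fun y => `[< exists x, u x = y >])) Sy.
  apply/asboolP; apply: Sy => [|a /uA ux]; last exact/asboolP.
  split=> [|_ _ /asboolP[x1 <-] /asboolP[x2 <-]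
           |_ _ /asboolP[x1 <-] /asboolP[x2 <-]]; apply/asboolP.
  - by exists 1; rewrite rmorph1.
  - by exists (x1 - x2); rewrite rmorphB.
  - by exists (x1 * x2); rewrite rmorphM.
pose g y := projT1 (cid (lift y)).
have ug y : u (g y) = Zadj_val y := projT2 (cid (lift y)).
pose phi (y : Zadj A) : F := v (g y).
have phiE y x : Zadj_val y = u x -> phi y = v x.
  move=> yx; apply/eqP; rewrite -subr_eq0 -rmorphB; apply/eqP/ker_uv.
  by rewrite rmorphB ug yx subrr.
have phiB : zmod_morphism phi.
  by move=> y1 y2; rewrite -rmorphB; apply: phiE; rewrite rmorphB !ug.
have phiM : monoid_morphism phi.
  split; first by rewrite -(rmorph1 v); apply: phiE; rewrite rmorph1.
  by move=> y1 y2; rewrite -rmorphM; apply: phiE; rewrite rmorphM !ug.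
pose phiBm := GRing.isZmodMorphism.Build _ _ phi phiB.
pose phiMm := GRing.isMonoidMorphism.Build _ _ phi phiM.
pose phi' : {rmorphism Zadj A -> F} := HB.pack phi phiBm phiMm.
by exists phi'.
Qed.

Lemma logb_gt_nat (R : realType) (b x : R) (m : nat) :
  1 < b -> m%:R < logb b x -> b ^+ m < x.
Proof.
move=> b_gt1; have lnb_gt0 : 0 < exp.ln b by apply: exp.ln_gt0.
have b_gt0 : 0 < b by apply: lt_trans b_gt1.
rewrite /logb ltr_pdivlMr // => lt_m.
(* For [x <= 0] the default value [exp.ln x = 0] contradicts [lt_m], whose left-hand side is
   nonnegative. *)
have [x_gt0|x_le0] := ltP 0 x; last first.
  by move: lt_m; rewrite (exp.ln0 x_le0) ltNge mulr_ge0 // ltW.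
rewrite -exp.ltr_ln ?posrE ?exprn_gt0 //.
by rewrite exp.lnXn // -mulr_natl.
Qed.

Theorem theorem1p3 (R : realType) (k p : nat) (A : {fset 'F_p}) :
  (2 <= k)%N -> prime p ->
  (#|` A|)%:R <
    logb 2 (logb (2 * k)%:R (logb (2 * k ^ 2)%:R p%:R)) - 1 :> R ->
  exists (K : fieldExtType rat) (A' : {fset K})
    (phi_p : {rmorphism Zadj A' -> 'F_p}) (phi : A' -> A),
    [/\ (\dim {:K} <= (2 * k) ^ (2 ^ #|` A|))%N,
        forall a : A', val (phi a) = phi_p (Zadj_gen a)
      & freiman_ring_iso k phi].
Proof.
move=> k_ge2 p_pr lt_log; set n := #|` A| in lt_log *.
have p_large : (k ^ (2 * k) ^ (2 ^ n - 1) < p)%N.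
  (* Each logarithm is removed by [logb_gt_nat]; the [- 1] in the hypothesis becomes the exponent
     [n.+1]. *)
  have : ((2 * k ^ 2) ^ ((2 * k) ^ (2 ^ n.+1)) < p)%N.
    rewrite -(ltr_nat R) natrX; apply: logb_gt_nat; first by rewrite ltr1n; lia.
    rewrite natrX; apply: logb_gt_nat; first by rewrite ltr1n; lia.
    rewrite natrX; apply: logb_gt_nat; first by rewrite ltr1n.
    by rewrite -natr1 -ltrBrDr.
  apply: leq_ltn_trans; apply: (@leq_trans (k ^ ((2 * k) ^ (2 ^ n.+1)))%N).
    rewrite leq_pexp2l ?leq_pexp2l //; try lia.
    by rewrite (leq_trans (leq_subr _ _)) // leq_pexp2l.
  by rewrite leq_exp2r ?expn_gt0; nia.
have cardA : #|{: A}| = n by rewrite -cardfE.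
have [X [X_le Xv]] := iterPoly_vars n.
pose a (i : 'I_n) : A := enum_val (cast_ord (esym cardA) i).
have [v vX] := Xv 'F_p (fun i => val (a i)).
have [||L [u [dimL ker_uv bnd]]] := number_field_lift v p_pr _ _ p_large;
  try lia.
pose A' : {fset L} := [fset u (X i) | i : 'I_n]%fset.
have A'P (b : A') : exists i, val b = u (X i).
  by have /imfsetP[i _ bE] := valP b; exists i.
pose idx b := projT1 (cid (A'P b)).
have idxE b : val b = u (X (idx b)) := projT2 (cid (A'P b)).
have [|phi_p phi_pE] := @Zadj_rmorphism _ _ _ u v A' ker_uv.
  by move=> b /imfsetP[i _ ->]; exists (X i).
have a_inj : injective a by move=> i j /enum_val_inj /cast_ord_inj.
(* Equal lifts would have equal images under [v], whereas the [a i] are distinct; hence [A'] has as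
   many elements as [A]. *)
have uX_inj i j : u (X i) = u (X j) -> i = j.
  move=> uX; apply/a_inj/val_inj/eqP; rewrite -!vX -subr_eq0 -rmorphB.
  by apply/eqP/ker_uv; rewrite rmorphB uX subrr.
have uX_A' i : u (X i) \in A' by apply/imfsetP; exists i.
exists L, A', phi_p, (fun b => a (idx b)); split.
- by rewrite (leq_trans dimL) // leq_pexp2l ?leq_subr //; lia.
- by move=> b; rewrite -vX; apply/esym/phi_pE; rewrite /= -idxE.
split.
  exists (fun c => [` uX_A' (cast_ord cardA (enum_rank c))]%fset).
    move=> b; apply: val_inj; rewrite /= idxE; congr (u (X _)).
    by rewrite enum_valK cast_ordKV.
  move=> c; set b := [` _]%fset; have := idxE b => /uX_inj <-.
  by rewrite /a cast_ordK enum_rankK.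
(* Both evaluations of [f] are images of the same element [eval_at Y f], under [u] and [v]; the two
   implications are then [ker_uv] and [bnd]. *)
move=> f f_bnd; pose Y (i : 'I_#|{: A'}|) := X (idx (enum_val i)).
have [nY dY] := @eval_at_bounded (iterPoly n) k k _ f Y f_bnd (fun i => X_le _).
have -> : eval_at (fun i => val (enum_val i)) f = u (eval_at Y f).
  rewrite rmorph_eval_at; congr (eval_at _ f); apply: funext => i.
  exact: idxE.
have -> : eval_at (fun i => val (a (idx (enum_val i)))) f = v (eval_at Y f).
  rewrite rmorph_eval_at; congr (eval_at _ f); apply: funext => i.
  by rewrite vX.
by split; [apply: ker_uv | apply: bnd].
Qed.
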